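(* For all integers $n\ge 2$ and $d$, the $(n-1)\times(n-1)$ matrix $B(n,d)=\bigl(b_{n,d}(i,j)\bigr)_{i,j=1}^{n-1}$ is Toeplitz, i.e. $b_{n,d}(i+1,j+1)=b_{n,d}(i,j)$ for all $i,j\in[n-2]$.
   Context: For a permutation $\pi=\pi_1\cdots\pi_n$ of $[n]$ (one-line notation) or any word of distinct integers, an ascent is a position $t$ with $\pi_t<\pi_{t+1}$ and a descent one with $\pi_t>\pi_{t+1}$; $\operatorname{des}(\pi)$ is the number of descents and the height $h$ of a word is its number of ascents minus its number of descents. $\pi$ is a ballot permutation if every prefix $\pi_1\cdots\pi_t$ ($t\in[n]$) has nonnegative height. $\mathscr{B}_{n,d}$ is the set of ballot permutations of $[n]$ with exactly $d$ descents, and $b_{n,d}(i,j)$ is the number of $\pi\in\mathscr{B}_{n,d}$ that contain $i\,n\,j$ as a factor (consecutive letters $\pi_t=i,\pi_{t+1}=n,\pi_{t+2}=j$ for some $t$). *)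

(* Defs.v *)
From mathcomp Require Import all_boot all_order all_algebra all_fingroup.
Set Implicit Arguments. Unset Strict Implicit. Unset Printing Implicit Defensive.

Definition consec_pairs (w : seq nat) : seq (nat * nat) := zip w (behead w).

Definition nasc (w : seq nat) : nat := count (fun p => p.1 < p.2) (consec_pairs w).
Definition ndes (w : seq nat) : nat := count (fun p => p.1 > p.2) (consec_pairs w).

Definition height (w : seq nat) : int := (Posz (nasc w) - Posz (ndes w))%R.

Definition ballot (w : seq nat) : bool :=
  all (fun t => (0 <= height (take t w))%R) (iota 1 (size w)).

(* one-line notation of a permutation s of [n] = {1..n}, represented by
   a permutation of 'I_n shifted by one: pi_t = s(t-1) + 1 *)
Definition oneline (n : nat) (s : 'S_n) : seq nat :=
  [seq (s i : nat).+1 | i <- enum 'I_n].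

Definition bcount (n : nat) (d : int) (i j : nat) : nat :=
  #|[set s : 'S_n | ballot (oneline s)
                    & (Posz (ndes (oneline s)) == d)
                    && infix [:: i; n; j] (oneline s)]|.

(* Main.v *)
(** Deleting the letter n - 1 from a word counted by b(i, j), or the letter 1
from a word counted by b(i + 1, j + 1), and standardizing the other letters
while keeping n on top, yields the same skeletons.  Fix a skeleton with its
up/down steps.  Away from its ends, and away from the peak i n j, inserting a
new maximum replaces one step by up-down, and inserting a new minimum replaces
it by down-up.  The two insertions have the same number of descents and both
stay ballot, except at a step leaving height 0, where only up-down survives:
- for an up step, this happens exactly when it is the last one leaving height
  0 and the path ends above 0, i.e. when the minimum can be appended at the end;
- for a down step, it is the first descent to height -1; then the minimum can be
  prepended, whereas the maximum cannot be appended.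
So every skeleton admits as many insertions of either kind with d descents. *)

Require Import Defs.
From mathcomp Require Import all_boot all_order all_algebra all_fingroup.
From mathcomp Require Import zify.
Set Implicit Arguments. Unset Strict Implicit. Unset Printing Implicit Defensive.

(** * Nonnegative up/down paths and the replacement of one step by two *)

Fixpoint nonneg_path (h : nat) (s : seq bool) : bool :=
  match s with
  | [::] => true
  | true :: s' => nonneg_path h.+1 s'
  | false :: s' => (0 < h) && nonneg_path h.-1 s'
  end.

(** Models the insertion of a letter strictly inside a word: the step across the slot gives way to
    the two steps around the new letter. *)
Definition replace_step (t : nat) (u s : seq bool) : seq bool :=
  take t s ++ u ++ drop t.+1 s.

Lemma nonneg_path_rcons_up h s :
  nonneg_path h (rcons s true) = nonneg_path h s.
Proof. by elim: s h => [|[] s IHs] h //=; rewrite IHs. Qed.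

(* The extra left-hand term [nonneg_path h.-1 s] vanishes at [h = 0]; it is
   there to make the induction on [s] go through. *)
Lemma nonneg_path_up_steps h s :
  \sum_(0 <= t < size s)
      (nth true s t && nonneg_path h (replace_step t [:: true; false] s))
    + ((0 < h) && nonneg_path h.-1 s)
  = \sum_(0 <= t < size s)
      (nth true s t && nonneg_path h (replace_step t [:: false; true] s))
    + nonneg_path h (rcons s false).
Proof.
elim: s h => [|b s IHs] h; first by rewrite !big_geq.
rewrite !big_nat_recl // /replace_step /= !drop0; case: b; case: h => [|h] /=.
- by rewrite addn0 add0n addnC; exact: (IHs 1).
- by rewrite -!addnA; congr (_ + _); exact: (IHs h.+2).
- by [].
- exact: IHs.
Qed.

(** The sums differ only through the first descent from height 0 to -1, if there is one. Putting
    up-down there lifts the remaining path by one, so it survives exactly when [s] is nonnegative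
    from [h.+1]; down-up fails. If there is no such descent, both extra terms equal 1. *)
Lemma nonneg_path_down_steps h s :
  \sum_(0 <= t < size s)
      (~~ nth true s t && nonneg_path h (replace_step t [:: true; false] s))
    + nonneg_path h s
  = \sum_(0 <= t < size s)
      (~~ nth true s t && nonneg_path h (replace_step t [:: false; true] s))
    + nonneg_path h.+1 s.
Proof.
elim: s h => [|b s IHs] h; first by rewrite !big_geq.
rewrite !big_nat_recl // /replace_step /= !drop0; case: b; case: h => [|h] /=.
- exact: (IHs 1).
- exact: (IHs h.+2).
- by rewrite addn0 add0n addnC.
- by rewrite -!addnA; congr (_ + _); exact: IHs.
Qed.

Lemma count_replace_step (a : pred bool) u s t : t < size s ->
  count a (replace_step t u s) + a (nth true s t) = count a s + count a u.
Proof.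
move=> lt_ts; rewrite -{3}(cat_take_drop t s) (drop_nth true lt_ts).
by rewrite /replace_step !count_cat /=; lia.
Qed.

(** The descent condition is an arbitrary predicate [e], so that the integer [d], possibly negative,
    can be plugged in later. *)
Definition good_path (e : pred nat) (s : seq bool) : bool :=
  nonneg_path 0 s && e (count negb s).

(** The extra terms are insertions at the ends: a maximum appended on the left, a minimum prepended
    or appended on the right. A prepended maximum starts with a descent and never contributes. *)
Lemma sum_good_path_replace e s :
  \sum_(0 <= t < size s) good_path e (replace_step t [:: true; false] s)
    + good_path e (rcons s true)
  = \sum_(0 <= t < size s) good_path e (replace_step t [:: false; true] s)
    + good_path e (true :: s) + good_path e (rcons s false).
Proof.
(* Replacing an up step adds one descent and replacing a down step adds none, so [e] factors out of
   each of the two sums. *)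
have split_sum u : count negb u = 1 ->
    \sum_(0 <= t < size s) good_path e (replace_step t u s)
    = e (count negb s).+1
      * \sum_(0 <= t < size s)
          (nth true s t && nonneg_path 0 (replace_step t u s))
    + e (count negb s)
      * \sum_(0 <= t < size s)
          (~~ nth true s t && nonneg_path 0 (replace_step t u s)).
  move=> u1; rewrite !big_distrr -big_split; apply: eq_big_nat => t lt_ts /=.
  have := count_replace_step negb u lt_ts; rewrite u1 /good_path.
  case: (nth true s t) => /= eq_count.
    have -> : count negb (replace_step t u s) = (count negb s).+1 by lia.
    by rewrite muln0 addn0 mulnb andbC.
  have -> : count negb (replace_step t u s) = count negb s by lia.
  by rewrite muln0 add0n mulnb andbC.
rewrite !split_sum //.
have := nonneg_path_up_steps 0 s; have := nonneg_path_down_steps 0 s.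
rewrite /good_path nonneg_path_rcons_up -!cats1 !count_cat /= !addn0 addn1 => E1 E2.
case: (e _); case: (e _) => /=; rewrite ?andbT ?andbF; lia.
Qed.

Lemma nonneg_path_cat h s1 s2 s2' :
  (forall h', nonneg_path h' s2 = nonneg_path h' s2') ->
  nonneg_path h (s1 ++ s2) = nonneg_path h (s1 ++ s2').
Proof. by move=> eq_s2; elim: s1 h => [|[] s IHs] h //=; rewrite IHs. Qed.

(** At the up step of the peak, up-down-down and down-up-down both require a positive starting
    height. At its down step, up-up-down and up-down-up require nothing. Descents and net rise agree
    in each pair. *)
Lemma good_path_replace_peak e s1 s2 (t := size s1) (s := s1 ++ [:: true, false & s2]) :
  good_path e (replace_step t [:: true; false] s)
    = good_path e (replace_step t [:: false; true] s)
  /\ good_path e (replace_step t.+1 [:: true; false] s)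
    = good_path e (replace_step t.+1 [:: false; true] s).
Proof.
have replaceE u : replace_step t u s = s1 ++ u ++ false :: s2.
  by rewrite /replace_step take_size_cat // /s -cat_rcons drop_size_cat ?size_rcons.
have replace1E u : replace_step t.+1 u s = s1 ++ true :: u ++ s2.
  rewrite /replace_step /s -cat_rcons take_size_cat ?size_rcons //.
  rewrite -[rcons s1 true ++ false :: s2]cat_rcons.
  by rewrite drop_size_cat ?size_rcons // cat_rcons.
rewrite /good_path !replaceE !replace1E !count_cat /=.
by split; congr (_ && _); apply: nonneg_path_cat => -[|h].
Qed.

(** * The step sequence of a word *)

Definition steps (w : seq nat) : seq bool :=
  if w is x :: w' then pairmap (fun a b => a < b) x w' else [::].

Lemma size_steps w : size (steps w) = (size w).-1.
Proof. by case: w => //= x w; rewrite size_pairmap. Qed.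

Lemma steps_map f w : {mono f : a b / a < b} -> steps (map f w) = steps w.
Proof.
by move=> f_mono; case: w => //= x w; elim: w x => //= y w IHw x; rewrite f_mono IHw.
Qed.

Lemma nasc_steps w : nasc w = count id (steps w).
Proof.
case: w => //= x w; elim: w x => //= y w IHw x.
by rewrite -IHw.
Qed.

Lemma ndes_steps w : uniq w -> ndes w = count negb (steps w).
Proof.
case: w => //= x w; elim: w x => //= y w IHw x /andP[x_notin yw_uniq].
rewrite -(IHw y yw_uniq) /ndes /consec_pairs /=; congr (_ + _).
by move: x_notin; rewrite inE negb_or -leqNgt; case: (ltngtP y x).
Qed.

Lemma nonneg_path_rcons h s b :
  nonneg_path h (rcons s b)
  = nonneg_path h s && (count negb (rcons s b) <= h + count id (rcons s b)).
Proof.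
elim: s h => [|[] s IHs] h /=; first by case: b => /=; lia.
  by rewrite IHs add0n addSnnS.
by rewrite IHs andbA; case: h => //= h; lia.
Qed.

Lemma steps_rcons w x : 0 < size w -> steps (rcons w x) = rcons (steps w) (last 0 w < x).
Proof. by case: w => //= y w _; rewrite -cats1 pairmap_cat cats1. Qed.

Lemma ballot_steps w : uniq w -> 0 < size w -> ballot w = nonneg_path 0 (steps w).
Proof.
(* Appending a letter creates a single new prefix, the whole word, hence a single new height
   condition. *)
elim/last_ind: w => // w x IHw; case: (posnP (size w)) => [/size0nil-> //|w_gt0].
rewrite rcons_uniq => /andP[x_notin w_uniq] _.
rewrite steps_rcons // nonneg_path_rcons -IHw // -steps_rcons // -nasc_steps.
rewrite -ndes_steps ?rcons_uniq ?x_notin // /ballot size_rcons.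
rewrite -[(size w).+1]addn1 iotaD all_cat.
congr (_ && _).
  apply/eq_in_all => t; rewrite mem_iota add1n ltnS => /andP[_ le_tw].
  by rewrite -cats1 takel_cat.
by rewrite /= andbT add1n take_oversize ?size_rcons // /height; lia.
Qed.

(** * Insertion of a letter into a word *)

Definition insert (k m : nat) (w : seq nat) : seq nat := take k w ++ m :: drop k w.

Lemma perm_insert k m w : perm_eq (insert k m w) (m :: w).
Proof. by rewrite perm_catC /= perm_cons perm_catC cat_take_drop. Qed.

Lemma insert_rem m w k : m \notin w -> [seq x <- insert k m w | x != m] = w.
Proof.
move=> m_notin; rewrite filter_cat /= eqxx -filter_cat cat_take_drop.
by apply/all_filterP/allP => x x_w; apply: contraNneq m_notin => <-.
Qed.

Lemma index_insert m w k : m \notin w -> k <= size w -> index m (insert k m w) = k.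
Proof.
move=> m_notin le_kw; rewrite index_cat /= eqxx addn0 size_takel //.
by rewrite ifN //; apply: contra m_notin => /mem_take.
Qed.

Lemma steps_insert_first m w : 0 < size w ->
  steps (insert 0 m w) = (m < head 0 w) :: steps w.
Proof. by case: w. Qed.

Lemma steps_insert_last m w : 0 < size w ->
  steps (insert (size w) m w) = rcons (steps w) (last 0 w < m).
Proof.
by move=> w_gt0; rewrite /insert take_size drop_size cats1 steps_rcons.
Qed.

Lemma steps_insert t m w : t.+1 < size w ->
  steps (insert t.+1 m w)
  = replace_step t [:: nth 0 w t < m; m < nth 0 w t.+1] (steps w).
Proof.
elim: w t => // x w IHw [|t] lt_tw.
  by case: w lt_tw {IHw} => //= y w _; rewrite /replace_step /insert /= !drop0.
case: w lt_tw IHw => // y w lt_tw IHw.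
have := IHw t lt_tw; rewrite /replace_step /insert /= => ->.
by [].
Qed.

(** * Arrangements obtained by insertion and relabelling *)

Lemma perm_permutations_insert m l : m \notin l ->
  perm_eq (permutations (m :: l))
          [seq insert k m w | w <- permutations l, k <- iota 0 (size w).+1].
Proof.
move=> m_notin.
have m_notin_perm w : w \in permutations l -> m \notin w.
  by rewrite mem_permutations => /perm_mem->.
apply/uniq_perm => [||v]; first exact: permutations_uniq.
  apply/allpairs_uniq_dep => [|w _|]; rewrite ?permutations_uniq ?iota_uniq //.
  move=> _ _ /allpairsPdep[w [k [w_in k_in ->]]]
    /allpairsPdep[w' [k' [w'_in k'_in ->]]] /= E.
  (* Deleting [m] recovers the word; the index of [m] then recovers the slot. *)
  have Ew : w = w'.
    by rewrite -(insert_rem k (m_notin_perm _ w_in)) E insert_rem ?m_notin_perm.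
  move: E k_in; rewrite -{w'}Ew in k'_in w'_in * => E k_in; congr existT.
  move: k_in k'_in; rewrite !mem_iota !ltnS => k_in k'_in.
  by rewrite -(index_insert (m_notin_perm _ w_in) k_in) E index_insert ?m_notin_perm.
rewrite mem_permutations; apply/idP/allpairsPdep => [v_perm|]; last first.
  case=> w [k [w_in _ ->]].
  by rewrite (permPl (perm_insert _ _ _)) perm_cons -mem_permutations.
have m_in : m \in v by rewrite (perm_mem v_perm) mem_head.
case/splitPr: m_in v_perm => v1 v2 v_perm.
exists (v1 ++ v2), (size v1).
rewrite /insert take_size_cat // drop_size_cat //; split => //;
  last by rewrite mem_iota size_cat /= ltnS leq_addr.
rewrite mem_permutations -(perm_cons m) -(permPr v_perm).
by rewrite perm_sym (perm_catCA v1 [:: m] v2).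
Qed.

Lemma perm_permutations_map (f : nat -> nat) l : injective f ->
  perm_eq (permutations (map f l)) (map (map f) (permutations l)).
Proof.
move=> f_inj; apply/uniq_perm => [||v]; first exact: permutations_uniq.
  by rewrite map_inj_uniq ?permutations_uniq //; apply: inj_map.
rewrite mem_permutations; apply/idP/mapP => [|[w w_in ->]]; last first.
  by apply: perm_map; rewrite -mem_permutations.
move=> /(perm_iotaP (f 0))[s s_perm ->]; exists (map (nth 0 l) s).
  rewrite mem_permutations; apply/(perm_iotaP 0); exists s => //.
  by rewrite size_map in s_perm.
rewrite -map_comp; apply/eq_in_map => k; rewrite (perm_mem s_perm) mem_iota => /= lt_k.
by rewrite (nth_map 0) // -(size_map f).
Qed.

Lemma ltn_bump2 h : {mono bump h : a b / a < b}.
Proof. by move=> a b; rewrite /bump; lia. Qed.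

Lemma bump_inj h : injective (bump h).
Proof. by move=> a b; rewrite /bump; lia. Qed.

Lemma perm_iota_bump n m : 0 < m <= n.+1 ->
  perm_eq (iota 1 n.+1) (m :: map (bump m) (iota 1 n)).
Proof.
move=> m_bound; apply: uniq_perm; rewrite ?iota_uniq //.
  rewrite cons_uniq (map_inj_uniq (@bump_inj m)) iota_uniq andbT.
  by apply/mapP => -[x _]; rewrite /bump; lia.
move=> x; rewrite mem_iota inE; apply/idP/orP => [x_in|[/eqP->|/mapP[y]]].
- have [-> //|x_neq] := eqVneq x m; [by left | right].
  apply/mapP; exists (unbump m x); last by rewrite /bump /unbump; lia.
  by rewrite mem_iota /unbump; lia.
- lia.
- by rewrite mem_iota /bump => y_in ->; lia.
Qed.

(** Deletion and standardization read backwards: each arrangement of [n+1] comes from exactly one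
    skeleton on [n] and one slot for [m]. *)
Lemma count_permutations_bump (P : pred (seq nat)) n m : 0 < m <= n.+1 ->
  count P (permutations (iota 1 n.+1))
  = \sum_(w <- permutations (iota 1 n))
      \sum_(0 <= k < (size w).+1) P (insert k m (map (bump m) w)).
Proof.
move=> m_bound; rewrite (seq.permP (perm_permutations (perm_iota_bump m_bound))).
rewrite (seq.permP (perm_permutations_insert _)); last first.
  by apply/mapP => -[x _]; rewrite /bump; lia.
rewrite count_flatten sumnE !big_map.
rewrite (perm_big _ (perm_permutations_map _ (@bump_inj m))) big_map.
apply: eq_bigr => w _; rewrite count_map size_map -sum1_count big_mkcond.
by rewrite /index_iota subn0; apply: eq_bigr => k _ /=; case: (P _).
Qed.

(** * The factor i n j under insertion *)

Lemma infix_map (f : nat -> nat) v w : injective f ->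
  infix (map f v) (map f w) = infix v w.
Proof.
move=> f_inj; apply/infixP/infixP => [[a [b E]]|[a [b ->]]]; last first.
  by exists (map f a), (map f b); rewrite !map_cat.
exists (take (size a) w), (drop (size a + size v) w); apply: (inj_map f_inj).
rewrite !map_cat map_take map_drop E take_size_cat // addnC -drop_drop drop_size_cat //.
by rewrite -(size_map f v) drop_size_cat.
Qed.

Lemma infix_filter (a : pred nat) v w : infix v w -> infix (filter a v) (filter a w).
Proof. by move=> /infixP[x [y ->]]; rewrite !filter_cat infix_infix. Qed.

Lemma infix_uniq_nbrs (n i j : nat) v1 v2 : uniq (v1 ++ n :: v2) ->
  infix [:: i; n; j] (v1 ++ n :: v2) -> last n v1 = i /\ head n v2 = j.
Proof.
move=> v_uniq /infixP[a [b]]; rewrite /= -(cat_rcons i a) => E.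
have n_v1 : n \notin v1.
  by move: v_uniq; rewrite cat_uniq /= negb_or => /and3P[_ /andP[]].
have n_a : n \notin rcons a i.
  by move: v_uniq; rewrite E cat_uniq /= negb_or => /and3P[_ /andP[]].
have sizeE : size v1 = size (rcons a i).
  have := congr1 (index n) E.
  by rewrite !index_cat (negPf n_v1) (negPf n_a) /= eqxx !addn0.
move: E => /eqP; rewrite eqseq_cat // => /andP[/eqP-> /eqP[->]].
by rewrite last_rcons.
Qed.

Lemma infix_insert (i n j : nat) A C m k (w := A ++ [:: i, n, j & C]) :
  uniq w -> m \notin w -> k <= size w ->
  infix [:: i; n; j] (insert k m w) = (k != (size A).+1) && (k != (size A).+2).
Proof.
move=> w_uniq m_notin le_kw.
have ins_uniq : uniq (insert k m w).
  by rewrite (perm_uniq (perm_insert _ _ _)) /= m_notin.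
have [m_i m_n m_j] : [/\ m != i, m != n & m != j].
  by move: m_notin; rewrite /w mem_cat !inE !negb_or => /and5P[].
have insertE l : k = size A + l -> insert k m w = A ++ insert l m [:: i, n, j & C].
  move=> ->; rewrite /insert /w takeD [in drop (_ + _) _]addnC -drop_drop.
  by rewrite take_size_cat // drop_size_cat // catA.
(* The slots |A|+1 and |A|+2 make [m] a neighbour of [n], whose neighbours in a factor i n j must be
   [i] and [j]. *)
case: (eqVneq k (size A).+1) => [Ek|k1] /=.
  move: ins_uniq; rewrite (insertE 1) ?Ek ?addn1 // /insert /=.
  rewrite -(cat_rcons i A) -(cat_rcons m) => ins_uniq.
  apply/negP => /(infix_uniq_nbrs ins_uniq)[].
  by rewrite last_rcons => /eqP; rewrite (negPf m_i).
case: (eqVneq k (size A).+2) => [Ek|k2] /=.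
  move: ins_uniq; rewrite (insertE 2) ?Ek ?addn2 // /insert /=.
  rewrite -(cat_rcons i A) => ins_uniq; apply/negP => /(infix_uniq_nbrs ins_uniq)[].
  by move=> _ /= /eqP; rewrite (negPf m_j).
have [le_kA|lt_Ak] := leqP k (size A).
  rewrite /insert /w takel_cat // drop_cat.
  case: ltnP => [lt_kA|le_Ak].
    by rewrite -cat_cons catA (infix_infix _ [:: i; n; j]).
  have -> : k - size A = 0 by lia.
  by rewrite drop0 -cat_rcons (infix_infix _ [:: i; n; j]).
rewrite (insertE (k - size A)) ?subnKC 1?ltnW //.
have [l ->] : exists l, k - size A = l.+3 by exists (k - (size A).+3); lia.
by rewrite /insert /= (infix_infix _ [:: i; n; j]).
Qed.

(** * Comparison of the two insertions on one skeleton *)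

Lemma sum_insert (e : pred nat) (i n j : nat) A C m u (w := A ++ [:: i, n, j & C])
    (s := steps w) :
  uniq w -> m \notin w ->
  (forall t, t.+1 < size w -> t != size A -> t != (size A).+1 ->
     [:: nth 0 w t < m; m < nth 0 w t.+1] = u) ->
  \sum_(0 <= k < (size w).+1)
    (infix [:: i; n; j] (insert k m w) && good_path e (steps (insert k m w)))
  = good_path e ((m < head 0 w) :: s)
    + \sum_(0 <= t < size s | (t != size A) && (t != (size A).+1))
        good_path e (replace_step t u s)
    + good_path e (rcons s (last 0 w < m)).
Proof.
move=> w_uniq m_notin u_steps.
have size_w : size w = (size A + size C).+3 by rewrite /w size_cat /= !addnS.
have size_s : size s = (size A + size C).+2 by rewrite size_steps size_w.
(* Slots 0 and |w| are the ends. The inner slot t+1 replaces step t, so the forbidden slots |A|+1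
   and |A|+2 correspond to the peak steps |A| and |A|+1. *)
rewrite big_nat_recl // [X in index_iota 0 X]size_w big_nat_recr // -size_w addnA.
have w_gt0 : 0 < size w by rewrite size_w.
congr (_ + _ + _).
- by rewrite infix_insert // steps_insert_first.
- rewrite size_s [RHS]big_mkcond /=; apply: eq_big_nat => t /andP[_ lt_t].
  rewrite infix_insert // ?size_w ?ltnS 1?ltnW // !eqSS.
  case: ifP => // /andP[tA tA1] /=.
  by rewrite steps_insert ?u_steps // size_w ltnS.
- rewrite infix_insert // steps_insert_last // size_w !eqSS.
  have [-> ->] // : (size A + size C).+2 != size A
    /\ (size A + size C).+1 != size A.
  by lia.
Qed.

(** The two peak steps contribute equally to both sides of [sum_good_path_replace], so they
    cancel. *)
Lemma sum_good_path_replace_off_peak e s1 s2 (s := s1 ++ [:: true, false & s2]) :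
  \sum_(0 <= t < size s | (t != size s1) && (t != (size s1).+1))
      good_path e (replace_step t [:: true; false] s)
    + good_path e (rcons s true)
  = \sum_(0 <= t < size s | (t != size s1) && (t != (size s1).+1))
      good_path e (replace_step t [:: false; true] s)
    + good_path e (true :: s) + good_path e (rcons s false).
Proof.
have := sum_good_path_replace e s.
pose off t := (t != size s1) && (t != (size s1).+1).
rewrite (bigID off) [in RHS](bigID off) /=.
have -> : \sum_(0 <= t < size s | ~~ off t)
              good_path e (replace_step t [:: true; false] s)
  = \sum_(0 <= t < size s | ~~ off t)
        good_path e (replace_step t [:: false; true] s).
  have [peak1 peak2] := good_path_replace_peak e s1 s2.
  apply: eq_bigr => t; rewrite negb_and !negbK => /orP[]/eqP->.
    by rewrite peak1.
  by rewrite peak2.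
set x := \sum_(_ <= t < _ | ~~ off t) _.
by rewrite addnAC -2![in RHS]addnA [x + _]addnC !addnA => /addIn.
Qed.

Lemma steps_peak i n j A C : i < n -> j < n ->
  exists s2, steps (A ++ [:: i, n, j & C]) = steps (rcons A i) ++ [:: true, false & s2].
Proof.
move=> lt_in lt_jn; exists (pairmap (fun a b => a < b) j C).
have nj : n < j = false by rewrite ltnNge ltnW.
case: A => [|a A] /=; first by rewrite lt_in nj.
by rewrite -cats1 !pairmap_cat -catA /= lt_in nj.
Qed.

Lemma sum_insert_max_min e N i j w : uniq w -> {in w, forall x, 0 < x <= N} ->
  0 < i < N -> 0 < j < N ->
  \sum_(0 <= k < (size w).+1)
    (infix [:: i; N.+1; j] (insert k N (map (bump N) w))
     && good_path e (steps (insert k N (map (bump N) w))))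
  = \sum_(0 <= k < (size w).+1)
    (infix [:: i.+1; N.+1; j.+1] (insert k 1 (map (bump 1) w))
     && good_path e (steps (insert k 1 (map (bump 1) w)))).
Proof.
move=> w_uniq w_bound i_bound j_bound.
have notin_bump m : m \notin map (bump m) w.
  by apply/mapP => -[x _]; rewrite /bump; lia.
have bumpN : map (bump N) [:: i; N; j] = [:: i; N.+1; j].
  by rewrite /= /bump !leqnn; do !f_equal; lia.
have bump1 : map (bump 1) [:: i; N; j] = [:: i.+1; N.+1; j.+1].
  by rewrite /= /bump; do !f_equal; lia.
case: (boolP (infix [:: i; N; j] w)) => [/infixP[A [C Ew]]|no_infix]; last first.
  (* Deleting [m] preserves the remaining factor, so a skeleton without i N j gives no
     contribution. *)
  have no_ins m k :
      infix (map (bump m) [:: i; N; j]) (insert k m (map (bump m) w)) = false.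
    apply: contraNF no_infix => /(infix_filter (predC1 m)).
    rewrite insert_rem //.
    have /all_filterP-> : all (predC1 m) (map (bump m) [:: i; N; j]).
      by rewrite /= /bump; lia.
    by rewrite infix_map //; apply: bump_inj.
  by rewrite -bumpN -bump1 !big1 // => k _; rewrite no_ins.
have size_w : size w = (size A + size C).+3 by rewrite Ew size_cat /= !addnS.
have mapE m : map (bump m) w = map (bump m) A ++
    [:: bump m i, bump m N, bump m j & map (bump m) C].
  by rewrite Ew map_cat.
(* The top letter of the skeleton sits at index |A|+1 and becomes N+1; every other letter lies below
   the inserted [N]. *)
have nth_max t : t < size w -> t != (size A).+1 -> nth 0 (map (bump N) w) t < N.
  move=> lt_tw tA; rewrite (nth_map 0) //.
  have := w_bound _ (mem_nth 0 lt_tw).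
  have : nth 0 w t != N.
    have <- : nth 0 w (size A).+1 = N.
      by rewrite Ew nth_cat ltnNge leqnSn /= subSnn.
    by rewrite nth_uniq // size_w; lia.
  by move: (nth 0 w t) => x; rewrite /bump => /eqP; lia.
have nth_min t : t < size w -> 1 < nth 0 (map (bump 1) w) t.
  move=> lt_tw; rewrite (nth_map 0) //.
  have := w_bound _ (mem_nth 0 lt_tw).
  by move: (nth 0 w t) => x; rewrite /bump; lia.
have map_uniqE m : uniq (map (bump m) w) by rewrite map_inj_uniq //; apply: bump_inj.
have [s2 steps_w] := steps_peak A C (proj2 (andP i_bound)) (proj2 (andP j_bound)).
have size_s1 : size (steps (rcons A i)) = size A by rewrite size_steps size_rcons.
have := sum_good_path_replace_off_peak e (steps (rcons A i)) s2.
rewrite -steps_w -[A ++ _]Ew size_s1 => off_peak.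
have sizeE m : size (map (bump m) w) = size w by rewrite size_map.
rewrite -bumpN -bump1.
have sumE m u :
    (forall t, t.+1 < size w -> t != size A -> t != (size A).+1 ->
     [:: nth 0 (map (bump m) w) t < m; m < nth 0 (map (bump m) w) t.+1] = u) ->
  \sum_(0 <= k < (size w).+1)
    (infix (map (bump m) [:: i; N; j]) (insert k m (map (bump m) w))
     && good_path e (steps (insert k m (map (bump m) w))))
  = good_path e ((m < nth 0 (map (bump m) w) 0) :: steps w)
    + \sum_(0 <= t < size (steps w) | (t != size A) && (t != (size A).+1))
        good_path e (replace_step t u (steps w))
    + good_path e (rcons (steps w) (nth 0 (map (bump m) w) (size w).-1 < m)).
  move=> u_steps.
  have := @sum_insert e (bump m i) (bump m N) (bump m j)
            (map (bump m) A) (map (bump m) C) m u.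
  rewrite -!mapE size_map => /(_ (map_uniqE m) (notin_bump m)).
  rewrite sizeE => /(_ u_steps) ->.
  rewrite (steps_map _ (ltn_bump2 m)) nth0 -(sizeE m) nth_last.
  by [].
rewrite (sumE N [:: true; false]); last first.
  move=> t lt_t tA tA1; rewrite nth_max //; last by rewrite ltnW.
  by rewrite ltnNge ltnW // nth_max.
rewrite (sumE 1 [:: false; true]); last first.
  by move=> t lt_t _ _; rewrite nth_min // ltnNge ltnW // nth_min // ltnW.
(* Only the end terms remain. Neither end is the top letter, since [i] precedes it and [j] follows
   it; hence [N] prepended starts with a descent and its term vanishes. *)
rewrite [N < _]ltnNge (ltnW (nth_max 0 _ _)) ?size_w //=.
rewrite nth_max ?size_w //; last by rewrite neq_ltn !ltnS leq_addr orbT.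
rewrite nth_min ?size_w // [_ < 1]ltnNge (ltnW (nth_min _ _)) ?size_w //=.
by rewrite add0n off_peak; congr (_ + _); exact: addnC.
Qed.

(** * One-line notation and the conclusion *)

Lemma perm_oneline n :
  perm_eq (map (@oneline n) (enum 'S_n)) (permutations (iota 1 n)).
Proof.
have oneline_inj : injective (@oneline n).
  move=> s s' /eq_in_map eq_ss'; apply/permP => i; apply/val_inj/succn_inj.
  by apply: eq_ss'; rewrite mem_enum.
have all_uniq : uniq (map (@oneline n) (enum 'S_n)).
  by rewrite map_inj_uniq ?enum_uniq.
apply: uniq_perm => //; first exact: permutations_uniq.
(* Both lists have n! distinct entries, so inclusion is enough. *)
apply: (uniq_min_size all_uniq _ _).2; last first.
  by rewrite size_permutations ?iota_uniq // size_iota size_map -cardE card_Sn.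
move=> _ /mapP[s _ ->]; rewrite mem_permutations.
apply: uniq_perm; rewrite ?iota_uniq //.
  by rewrite map_inj_uniq ?enum_uniq // => a b /succn_inj/val_inj/perm_inj.
move=> x; rewrite mem_iota; apply/mapP/idP => [[k _ ->]|].
  by rewrite add1n; exact: ltn_ord.
case: x => //= x; rewrite add1n ltnS => lt_xn.
by exists (s^-1%g (Ordinal lt_xn)); rewrite ?mem_enum // permKV.
Qed.

Lemma bcount_permutations n d i j : 0 < n ->
  bcount n d i j
  = count (fun w => infix [:: i; n; j] w
                    && good_path (fun m => Posz m == d) (steps w))
          (permutations (iota 1 n)).
Proof.
move=> n_gt0; rewrite -(seq.permP (perm_oneline n)) -sum1_count big_map big_enum_cond.
rewrite /bcount -sum1_card; apply: eq_bigl => s; rewrite inE /=.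
have s_uniq : uniq (oneline s).
  by rewrite map_inj_uniq ?enum_uniq // => a b /succn_inj/val_inj/perm_inj.
have s_gt0 : 0 < size (oneline s) by rewrite size_map size_enum_ord.
by rewrite ballot_steps // ndes_steps // andbA andbC.
Qed.

Theorem theorem3p1 (n : nat) (d : int) :
  2 <= n ->
  forall i j : nat, 1 <= i <= n - 2 -> 1 <= j <= n - 2 ->
    bcount n d i.+1 j.+1 = bcount n d i j.
Proof.
case: n => // N n_ge2 i j i_bound j_bound.
rewrite !bcount_permutations //.
(* [bump 1] shifts [i] and [j] up, whereas [bump N] fixes them; both send the
   top letter [N] of a skeleton to [N.+1]. *)
rewrite (@count_permutations_bump _ N 1) // (@count_permutations_bump _ N N); last lia.
apply: eq_big_seq => w; rewrite mem_permutations => w_perm; symmetry.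
apply: sum_insert_max_min; [| |lia|lia].
  by rewrite (perm_uniq w_perm) iota_uniq.
by move=> x; rewrite (perm_mem w_perm) mem_iota; lia.
Qed.
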